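(* Let $\mu$ be a non-negative Borel measure on $\mathbb{R}$, absolutely continuous with respect to Lebesgue measure with density $\rho\in L^1_{\mathrm{loc}}(\mathbb{R})$. Let $\lambda:\mathbb{R}\to\mathbb{R}$ be a measurable function which is strictly monotone and continuously differentiable on some interval $\Delta\subset\mathbb{R}$. Let $r\in L^2(\mathbb{R},\mu)$ be a non-negative function with $$\int_\Delta (r(x))^2\rho(x)\,dx>0.$$ Then every trajectory $\Gamma\subset\mathbb{T}_r$ of the flow $\mathbf{\Phi}_t(u)=e^{it\lambda}u$, $t\in\mathbb{R}$, on $\mathcal{H}=L^2(\mathbb{R},\mu,\mathbb{C})$ is not periodic.
   Context: The system of harmonic oscillators considered is the Hamiltonian system on $\mathcal{H}=L^2(\mathbb{R},\mu,\mathbb{C})$ whose flow is $(\mathbf{\Phi}_tu)(x)=e^{it\lambda(x)}u(x)$. The invariant torus is $\mathbb{T}_r=\{u\in\mathcal{H}:|u(x)|=r(x)\text{ for }\mu\text{-a.e. }x\}$. The trajectory of $u$ is $\Gamma_u=\{\mathbf{\Phi}_tu:t\in\mathbb{R}\}$; it is periodic if there exists $T>0$ with $\mathbf{\Phi}_Tu=u$ in $\mathcal{H}$. *)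

(* Defs.v *)
From HB Require Import structures.
From mathcomp Require Export all_boot all_order all_algebra.
From mathcomp Require Export all_classical all_reals all_analysis.
From mathcomp Require Export measurable_realfun complex.

Set Implicit Arguments.
Unset Strict Implicit.
Unset Printing Implicit Defensive.

Import Order.TTheory GRing.Theory Num.Theory.
Import numFieldNormedType.Exports.
Import ComplexField.

Local Open Scope classical_set_scope.
Local Open Scope ring_scope.
Local Open Scope complex_scope.

Definition expi {R : realType} (a : R) : R[i] := cos a +i* sin a.

Lemma normc_expi {R : realType} (a : R) : Normc.normc (expi a) = 1.
Proof. by rewrite /Normc.normc /expi cos2Dsin2 sqrtr1. Qed.

Section complex_L2.
Context d (T : measurableType d) (R : realType).
Variable mu : {measure set T -> \bar R}.

Definition square_integrable (f : T -> R[i]) : Prop :=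
  [/\ measurable_fun setT (fun x => complex.Re (f x)),
      measurable_fun setT (fun x => complex.Im (f x)) &
      (\int[mu]_x ((Normc.normc (f x)) ^+ 2)%:E < +oo)%E].

Record L2fun := MkL2fun {
  L2fun_val :> T -> R[i];
  L2funP : square_integrable L2fun_val }.

HB.instance Definition _ := gen_eqMixin L2fun.
HB.instance Definition _ := gen_choiceMixin L2fun.

Definition L2_eq (f g : L2fun) : bool := `[< {ae mu, forall x, f x = g x} >].

Let L2_eq_refl : reflexive L2_eq.
Proof. by move=> f; apply/asboolP; exact: nearW. Qed.

Let L2_eq_sym : symmetric L2_eq.
Proof.
by move=> f g; apply/idP/idP => /asboolP fg; apply/asboolP;
  apply: filterS fg.
Qed.

Let L2_eq_trans : transitive L2_eq.
Proof.
move=> g f h /asboolP fg /asboolP gh; apply/asboolP.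
by apply: filterS2 fg gh => x -> ->.
Qed.

Canonical L2_eq_equiv := EquivRel L2_eq L2_eq_refl L2_eq_sym L2_eq_trans.

Local Open Scope quotient_scope.

Definition L2 : Type := {eq_quot L2_eq}.
HB.instance Definition _ := Choice.on L2.
HB.instance Definition _ := EqQuotient.on L2.

Definition L2_to_fun (u : L2) : T -> R[i] := repr u.
Coercion L2_to_fun : L2 >-> Funclass.

Lemma L2_piP (f g : L2fun) :
  \pi_L2 f = \pi_L2 g <-> {ae mu, forall x, f x = g x}.
Proof.
split=> [/eqmodP /asboolP //|fg]; by apply/eqmodP/asboolP.
Qed.

Lemma L2_eqP (u v : L2) : u = v <-> {ae mu, forall x, u x = v x}.
Proof. by rewrite -{1}[u]reprK -{1}[v]reprK L2_piP. Qed.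

Lemma L2_reprE (f : L2fun) : {ae mu, forall x, (\pi_L2 f : L2) x = f x}.
Proof. by apply/L2_piP; rewrite reprK. Qed.

Section flow.
Variable lam : {mfun T >-> R}.

Lemma square_integrable_rotate (t : R) (f : L2fun) :
  square_integrable (fun x => expi (t * lam x) * f x).
Proof.
have [mRe mIm fi] := L2funP f.
have mtl : measurable_fun setT (fun x => t * lam x).
  by apply: measurable_funM => //; exact: measurable_cst.
have mc : measurable_fun setT (fun x => cos (t * lam x)).
  apply: (measurableT_comp _ mtl).
  by apply: continuous_measurable_fun; exact: continuous_cos.
have ms : measurable_fun setT (fun x => sin (t * lam x)).
  apply: (measurableT_comp _ mtl).
  by apply: continuous_measurable_fun; exact: continuous_sin.
split.
- rewrite (_ : (fun _ => _) = fun x => cos (t * lam x) * complex.Re (f x) -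
                                       sin (t * lam x) * complex.Im (f x)).
    by apply: measurable_funB; exact: measurable_funM.
  by apply/funext => x; rewrite /expi; case: (f x).
- rewrite (_ : (fun _ => _) = fun x => cos (t * lam x) * complex.Im (f x) +
                                       sin (t * lam x) * complex.Re (f x)).
    by apply: measurable_funD; exact: measurable_funM.
  by apply/funext => x; rewrite /expi; case: (f x).
- by under eq_integral do rewrite Normc.normcM normc_expi mul1r.
Qed.

Definition rotate (t : R) (f : L2fun) : L2fun :=
  MkL2fun (square_integrable_rotate t f).

Definition flow (t : R) (u : L2) : L2 := \pi_L2 (rotate t (repr u)).

(* The flow does not depend on the representative chosen in its definition. *)
Lemma flow_pi (t : R) (f : L2fun) : flow t (\pi_L2 f) = \pi_L2 (rotate t f).
Proof. by apply/L2_piP; apply: filterS (L2_reprE f) => x /= <-. Qed.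

Lemma flowE (t : R) (u : L2) :
  {ae mu, forall x, flow t u x = expi (t * lam x) * u x}.
Proof. exact: L2_reprE. Qed.

Definition trajectory (u : L2) : set L2 := [set flow t u | t in [set: R]].

Definition periodic_trajectory (u : L2) : Prop :=
  exists2 t : R, 0 < t & flow t u = u.

End flow.

Definition torus (r : T -> R) : set L2 :=
  [set u | {ae mu, forall x, Normc.normc (u x) = r x}].

End complex_L2.

Arguments torus {d T R} mu r.

Section real_line.
Context (R : realType).

Definition ac_with_density (mu : {measure set (measurableTypeR R) -> \bar R})
    (rho : R -> R) : Prop :=
  mu `<< (@lebesgue_measure R) /\
  forall A : set (measurableTypeR R), measurable A ->
    mu A = (\int[@lebesgue_measure R]_(x in A) (rho x)%:E)%E.

Definition strictly_monotone_on (D : interval R) (f : R -> R) : Prop :=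
  {in D &, forall x y, x < y -> f x < f y} \/
  {in D &, forall x y, x < y -> f y < f x}.

(* Derivatives are taken along D, hence one-sided at the endpoints in D. *)
Definition C1_on (D : interval R) (f : R -> R) : Prop :=
  exists df : R -> R,
    (forall x, x \in D ->
       (f y - f x) / (y - x) @[y --> within [set` D] x^'] --> df x) /\
    {within [set` D], continuous df}.

End real_line.

(* Main.v *)
Require Import Defs.
From mathcomp Require Import lra.
Import Order.TTheory GRing.Theory Num.Theory.
Import numFieldNormedType.Exports.
Local Open Scope classical_set_scope.
Local Open Scope ring_scope.

(** If the trajectory of [u] has a period [t > 0], then
    [expi (t * lam x) * u x = u x] for [mu]-almost every [x]; since [|u| = r],
    almost every [x] with [r x != 0] is resonant, i.e. [t * lam x] is a
    multiple of [2 * pi].  On [Delta] the function [lam] is injective and the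
    multiples of [2 * pi] are countable, so [Delta] contains only countably
    many resonant points ([countable_resonant]).  A countable set is Lebesgue
    null, hence [mu]-null, and therefore [r = 0] [mu]-almost everywhere on
    [Delta].

    This contradicts the positivity of the integral of [r ^ 2 * rho] over
    [Delta].  The density [rho] is only nonnegative up to a null set, so the
    contradiction is read off from the set [P] of points of [Delta] where
    [r ^ 2 * rho > 0]: it is [mu]-null because [r] does not vanish on it, hence
    Lebesgue null because [rho > 0] on it ([null_set_of_density_gt0]), whereas
    a positive integral forces [P] to have positive Lebesgue measure
    ([integral_gt0_not_null]). *)

(** With [b = a / 2], the hypothesis reads [1 - 2 * sin b ^ 2 = 1], and [sin]
    has no zero in the open interval from [0] to [pi]; negative [a] reduce to
    positive ones because [cos] is even. *)
Lemma cos_eq1_small (R : realType) (a : R) :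
  cos a = 1 -> `|a| < pi *+ 2 -> a = 0.
Proof.
have pos (b : R) : cos b = 1 -> 0 < b -> b < pi *+ 2 -> False.
  move=> cb b0 b2pi.
  have /sin_gt0_pi s0 : 0 < b / 2 < pi.
    by rewrite divr_gt0//= ltr_pdivrMr// mulr_natr.
  have bE : b = (b / 2) *+ 2 by rewrite -mulr_natr divfK.
  move: cb; rewrite {1}bE cos_mulr2n cos2sin2 mulrnBl => /eqP.
  rewrite addrAC -[_ - 1]addrC addrA subr_eq addrC -subr_eq0.
  move=> /eqP cb.
  have : 0 < sin (b / 2) ^+ 2 by rewrite exprn_gt0.
  by move: cb; lra.
move=> ca; case: (ltrgtP a 0) => // [a0|a0] la; exfalso.
- by apply: (pos (- a)); rewrite ?cosN ?oppr_gt0// -ltr0_norm.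
- by apply: (pos a) => //; rewrite -(gtr0_norm a0).
Qed.

(** Two resonant points with the same number of full turns
    [floor (t * f x / (2 * pi))] have phases less than [2 * pi] apart, hence
    equal phases, hence coincide; so resonant points are coded by integers. *)
Lemma countable_resonant (R : realType) (T : eqType) (f : T -> R)
    (D : set T) (t : R) :
  t != 0 -> {in D &, injective f} ->
  countable [set x | D x /\ expi (t * f x) = 1%:C%C].
Proof.
move=> t0 finj; apply/countable_injP.
have pi20 : 0 < pi *+ 2 :> R by rewrite mulrn_wgt0// pi_gt0.
pose turns x := Num.floor (t * f x / (pi *+ 2)).
exists (choice.pickle \o turns) => x y; rewrite !inE /=.
move=> [Dx [cx sx]] [Dy [cy sy]] /(pcan_inj choice.pickleK) xy.
apply: finj; rewrite ?inE//; apply: (mulfI t0).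
apply/eqP; rewrite -subr_eq0; apply/eqP; apply: cos_eq1_small.
  by rewrite cosB cx cy sx sy mulr1 mulr0 addr0.
have /andP[x1 x2] := floor_itv (t * f x / (pi *+ 2)).
have /andP[y1 y2] := floor_itv (t * f y / (pi *+ 2)).
move: x1 x2 y1 y2; rewrite -!/(turns _) -xy intrD.
rewrite !ler_pdivlMr// !ltr_pdivrMr// mulrDl mul1r => x1 x2 y1 y2.
by rewrite ltr_norml; apply/andP; split; lra.
Qed.

(** The integral of [f] is that of its positive part minus that of its negative
    part, and a null set of positivity kills the former. *)
Lemma integral_gt0_not_null d (T : measurableType d) (R : realType)
    (m : {measure set T -> \bar R}) (D : set T) (f : T -> \bar R) :
  measurable D -> measurable_fun D f ->
  (0 < \int[m]_(x in D) f x)%E -> m (D `&` [set x | (0 < f x)%E]) <> 0%E.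
Proof.
move=> mD mf; rewrite integralE => + P0.
rewrite (_ : \int[m]_(x in D) f^\+ x = 0)%E; last first.
  (* the positive part of [f] vanishes on [D] outside the null set *)
  rewrite -(integral0 m D); apply: ae_eq_integral => //.
    exact: measurable_funepos.
  exists (D `&` [set x | (0 < f x)%E]); split => //.
    exact: emeasurable_fun_o_infty.
  move=> x /= /not_implyP[Dx fx]; split => //.
  by rewrite ltNge; apply/negP => fx0; apply: fx; rewrite funeposE max_r.
rewrite sub0e oppe_gt0; apply/negP; rewrite -leNgt.
exact: integral_ge0.
Qed.

(** Converts null sets of the measure with density [rho] back into null sets of
    the base measure: a function with zero integral and constant sign vanishes
    almost everywhere, which a positive function does nowhere. *)
Lemma null_set_of_density_gt0 d (T : measurableType d) (R : realType)
    (m : {measure set T -> \bar R}) (rho : T -> R) (P : set T) :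
  measurable P -> measurable_fun P rho -> {in P, forall x, 0 < rho x} ->
  (\int[m]_(x in P) (rho x)%:E)%E = 0%E -> m P = 0%E.
Proof.
move=> mP mrho rho0 Prho0.
have : (\int[m]_(x in P) `|(rho x)%:E|)%E = 0%E.
  rewrite -[RHS]Prho0; apply: eq_integral => x Px.
  by rewrite gee0_abs// lee_fin ltW// rho0.
have mrhoE : measurable_fun P (EFin \o rho) by apply/measurable_EFinP.
move=> /(ae_eq_integral_abs m mP mrhoE) aeP.
apply: measure_negligible => //; apply: negligibleS aeP => x Px /= /(_ Px)[].
by apply/eqP; rewrite gt_eqF// rho0// inE.
Qed.

Lemma strictly_monotone_on_inj (R : realType) (D : interval R) (f : R -> R) :
  strictly_monotone_on D f -> {in D &, injective f}.
Proof.
case=> fD x y xD yD fxy; case: (ltgtP x y) => // xy; exfalso.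
- by have := fD _ _ xD yD xy; rewrite fxy ltxx.
- by have := fD _ _ yD xD xy; rewrite fxy ltxx.
- by have := fD _ _ xD yD xy; rewrite fxy ltxx.
- by have := fD _ _ yD xD xy; rewrite fxy ltxx.
Qed.

Theorem theorem6p1 (R : realType)
  (mu : {measure set (measurableTypeR R) -> \bar R}) (rho : R -> R)
  (rho_loc : locally_integrable [set: R] rho)
  (mu_rho : ac_with_density mu rho)
  (lam : {mfun measurableTypeR R >-> R}) (Delta : interval R)
  (lam_mono : strictly_monotone_on Delta lam) (lam_C1 : C1_on Delta lam)
  (r : R -> R)
  (r_L2 : (r : measurableTypeR R -> R) \in Lfun mu (2%:E)%E)
  (r_ge0 : {ae mu, forall x, 0 <= r x})
  (r_Delta : (0 < \int[@lebesgue_measure R]_(x in [set` Delta])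
                    ((r x) ^+ 2 * rho x)%:E)%E) :
  forall u : L2 mu, trajectory lam u `<=` torus mu r ->
    ~ periodic_trajectory lam u.
Proof.
move=> u u_torus [t t0 flow_u].
(* The period itself puts [u = flow t u] on the trajectory. *)
have u_r : {ae mu, forall x, Normc.normc (u x) = r x}.
  by apply: u_torus; exists t.
have [mrho _ _] := rho_loc.
have [_ mu_int] := mu_rho.
have mr : measurable_fun setT (r : measurableTypeR R -> R).
  by have := sub_Lfun_mfun r_L2; rewrite inE.
have mDelta : measurable ([set` Delta] : set (measurableTypeR R)).
  exact: measurable_itv.
have mf : measurable_fun [set` Delta]
    (fun x : measurableTypeR R => ((r x) ^+ 2 * rho x)%:E).
  apply: (@measurable_funTS _ _ _ _ [set` Delta]).
  apply/measurable_EFinP; apply: measurable_funM => //.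
  exact: measurable_funX.
apply: (integral_gt0_not_null _ _ _ _ _ _ mDelta mf r_Delta).
set P := _ `&` _.
have mP : measurable P by exact: emeasurable_fun_o_infty.
have P_gt0 x : P x -> r x != 0 /\ 0 < rho x.
  move=> [_ /=]; rewrite lte_fin => rrho.
  have r0 : r x != 0.
    by apply: contraTneq rrho => ->; rewrite expr0n mul0r ltxx.
  by split => //; move: rrho; rewrite pmulr_rgt0// exprn_even_gt0.
apply: (null_set_of_density_gt0 _ (measurableTypeR R) _ lebesgue_measure rho)
  => //.
- exact: measurable_funTS.
- by move=> x /set_mem /P_gt0[].
rewrite -mu_int//.
(* [P] is [mu]-null because almost all of its points would be resonant. *)
pose Z : set (measurableTypeR R) :=
  [set x | x \in Delta /\ expi (t * lam x) = 1%:C%C].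
have cZ : countable Z.
  apply: (@countable_resonant R R lam [set` Delta]); first by rewrite gt_eqF.
  by move=> x y /set_mem xD /set_mem yD; exact: (strictly_monotone_on_inj _ _ _ lam_mono).
have mZ : measurable Z.
  by apply: countable_measurable => // x; exact: measurable_set1.
have muZ : mu Z = 0%E.
  rewrite mu_int//; apply: null_set_integral => //.
    by apply/measurable_EFinP; exact: measurable_funTS.
  exact: countable_lebesgue_measure0.
have aeZ : {ae mu, forall x, ~ Z x}.
  by exists Z; split => // x /= /contrapT.
have aeP : {ae mu, forall x, ~ P x}.
  have flowE_u := flowE lam t u; rewrite flow_u in flowE_u.
  near=> x.
  move=> Px; have [r0 _] := P_gt0 _ Px.
  have Zx : ~ Z x by near: x.
  have ux : u x = expi (t * lam x) * u x by near: x.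
  have rx : Normc.normc (u x) = r x by near: x.
  have ux0 : u x != 0.
    by apply: contraNneq r0 => u0; rewrite -rx u0 Normc.normc0.
  apply: Zx; split; first by case: Px.
  by apply: (mulIf ux0); rewrite mul1r -ux.
apply: measure_negligible => //.
by apply: negligibleS aeP => x Px /=; exact.
Unshelve. all: by end_near.
Qed.
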